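(* Let $X$ be a completely regular space, let $\beta X$ be its Stone–Čech compactification, and let $f:X\to\mathbb R$ be a Baire-one function. Then the following conditions are equivalent: (1) $f$ is functionally countably fragmented; (2) $f$ can be extended to a Baire-one function on $\beta X$, i.e. there exists a Baire-one function $g:\beta X\to\mathbb R$ with $g|_X=f$.
   Context: Completely regular spaces are assumed Hausdorff (Tychonoff). A map $f:X\to Y$ between topological spaces is Baire-one if it is the pointwise limit of a sequence of continuous maps $f_n:X\to Y$. A set $U\subseteq X$ is functionally open if $U=\varphi^{-1}((0,1])$ for some continuous $\varphi:X\to[0,1]$. A transfinite sequence $(U_\xi:\xi\in[0,\alpha])$ of subsets of a topological space $X$ ($\alpha$ an ordinal) is regular in $X$ if: (a) each $U_\xi$ is open in $X$; (b) it is increasing (not necessarily strictly), with $U_0=\emptyset$ and $U_\alpha=X$; (c) $U_\gamma=\bigcup_{\xi<\gamma}U_\xi$ for every limit ordinal $\gamma\in[0,\alpha]$. Let $(Y,d)$ be a metric space, $f:X\to Y$ a map, and $\varepsilon>0$. A regular sequence $(U_\xi:\xi\in[0,\alpha])$ in $X$ is $\varepsilon$-associated with $f$ if $\operatorname{diam} f(U_{\xi+1}\setminus U_\xi)<\varepsilon$ for all $\xi\in[0,\alpha)$ (the diameter of the empty set is $0$). The map $f$ is functionally $\varepsilon$-countably fragmented if there is a sequence $(U_\xi:\xi\in[0,\alpha])$ $\varepsilon$-associated with $f$ such that $\alpha$ is a countable (possibly finite) ordinal and every $U_\xi$ is functionally open in $X$. The map $f$ is functionally countably fragmented if it is functionally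 $\varepsilon$-countably fragmented for every $\varepsilon>0$. For real-valued functions, $\mathbb R$ carries the usual metric. *)

(* Defs.v *)
(* Library: MathComp-Analysis. *)
From HB Require Import structures.
From mathcomp Require Import all_boot all_order all_algebra.
From mathcomp Require Import all_classical all_reals all_analysis.
From mathcomp Require wochoice.

Set Implicit Arguments.
Unset Strict Implicit.
Unset Printing Implicit Defensive.

Import Order.TTheory GRing.Theory Num.Theory.
Import numFieldNormedType.Exports.

Local Open Scope classical_set_scope.
Local Open Scope ring_scope.

Definition baire_one {X Y : topologicalType} (f : X -> Y) : Prop :=
  exists2 f_ : nat -> X -> Y, (forall n, continuous (f_ n)) &
    forall x, f_ n x @[n --> \oo] --> f x.

Definition functionally_open (R : realType) {X : topologicalType}
    (U : set X) : Prop :=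
  exists2 phi : X -> R,
    continuous phi /\ (forall x, 0 <= phi x <= 1) & U = phi @^-1` `]0, 1].

(* The value 0 is added to the set of distances so that diam set0 = 0 (and not
   ereal_sup set0 = -oo); it changes nothing for a nonempty set. *)
Definition diam {R : realType} (A : set R) : \bar R :=
  ereal_sup (0%E |` [set (`|x - y|)%:E | x in A & y in A]).

(* An ordinal interval [0, alpha] is represented by a well-ordered type W with
   a least element \bot, in the role of 0, and a greatest element \top, in the
   role of alpha; every such W is order isomorphic to [0, alpha] for exactly one
   ordinal alpha, and W is countable if and only if alpha is. *)
Section ordinal_intervals.
Context {d : Order.disp_t} {W : tbOrderType d}.

Definition successor_of (xi eta : W) : Prop :=
  (xi < eta)%O /\ forall zeta : W, (xi < zeta)%O -> (eta <= zeta)%O.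

Definition limit_ordinal (gamma : W) : Prop :=
  gamma <> \bot%O /\ forall xi, ~ successor_of xi gamma.

Definition regular_sequence {X : topologicalType} (U : W -> set X) : Prop :=
  [/\ forall xi, open (U xi),
      forall xi eta, (xi <= eta)%O -> U xi `<=` U eta,
      U \bot%O = set0,
      U \top%O = [set: X] &
      forall gamma, limit_ordinal gamma ->
        U gamma = \bigcup_(xi in [set xi | (xi < gamma)%O]) U xi].

(* Every xi < \top has a unique successor, and successor_of xi eta forces
   xi < \top. *)
Definition associated {R : realType} {X : topologicalType} (eps : R)
    (f : X -> R) (U : W -> set X) : Prop :=
  regular_sequence U /\
  forall xi eta, successor_of xi eta ->
    (diam (f @` (U eta `\` U xi)) < eps%:E)%E.

End ordinal_intervals.

Definition functionally_eps_countably_fragmented {R : realType}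
    {X : topologicalType} (eps : R) (f : X -> R) : Prop :=
  exists (d : Order.disp_t) (W : tbOrderType d) (U : W -> set X),
    [/\ wochoice.well_order (<=%O : rel W),
        countable [set: W],
        associated eps f U &
        forall xi, functionally_open R (U xi)].

Definition functionally_countably_fragmented {R : realType}
    {X : topologicalType} (f : X -> R) : Prop :=
  forall eps : R, 0 < eps -> functionally_eps_countably_fragmented eps f.

(* The Stone-Cech compactification of X: the closure, with the subspace
   topology, of the image of X under the evaluation map into the cube
   [0, 1]^C(X, [0, 1]). The cube is closed in R^C(X, [0, 1]), so the closure may
   be taken in the latter space. *)
Section stone_cech.
Variables (R : realType) (X : topologicalType).

Definition unit_function : Type :=
  {phi : X -> R | continuous phi /\ forall x, 0 <= phi x <= 1}.

Definition cube_space : topologicalType :=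
  prod_topology (fun _ : unit_function => R).

Definition cube_eval (x : X) : cube_space := fun phi => sval phi x.

Definition stone_cech_set : set cube_space := closure (range cube_eval).

Definition stone_cech : topologicalType := set_type stone_cech_set.

Lemma cube_eval_stone_cech (x : X) : cube_eval x \in stone_cech_set.
Proof. by apply/mem_set/subset_closure; exists x. Qed.

Definition stone_cech_embed (x : X) : stone_cech :=
  exist _ (cube_eval x) (cube_eval_stone_cech x).

End stone_cech.

Section stone_cech_theory.
Variables (R : realType) (X : topologicalType).
Local Notation bX := (stone_cech R X).
Local Notation I := (unit_function R X).

Lemma stone_cech_coord_continuous (phi : I) :
  continuous (fun p : bX => (set_val p : cube_space R X) phi).
Proof.
move=> p.
apply: (@continuous_comp bX (cube_space R X) R set_val (fun q => q phi)).
  exact: initial_continuous.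
exact: (@proj_continuous {classic I} (fun=> R) phi).
Qed.

Lemma cube_eval_continuous : continuous (@cube_eval R X).
Proof.
move=> x; apply/cvg_sup => phi U [V [[W oW <-] /= Wx] WU].
suff : nbhs x (sval phi @^-1` W) by apply: filterS => y; exact: WU.
apply: (svalP phi).1; exact: open_nbhs_nbhs.
Qed.

Lemma stone_cech_embed_continuous : continuous (@stone_cech_embed R X).
Proof.
apply/continuousP => _ [V oV <-].
by have /continuousP := cube_eval_continuous; exact.
Qed.

Lemma stone_cech_embed_dense : dense (range (@stone_cech_embed R X)).
Proof.
move=> O [[p pc] Op] [V oV VO]; rewrite -VO in Op *.
have [] := set_mem pc V; first exact: open_nbhs_nbhs.
move=> _ [[x _ <-] Vx].
by exists (stone_cech_embed R x); split; [|exists x].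
Qed.

Lemma stone_cech_hausdorff : hausdorff_space bX.
Proof.
move=> p q pq; apply/val_inj/funext => phi.
apply: (@Rhausdorff R) => A B Ap Bq.
have [r [Ar Br]] := pq _ _ (stone_cech_coord_continuous Ap)
  (stone_cech_coord_continuous Bq).
by exists ((set_val r : cube_space R X) phi).
Qed.

Lemma stone_cech_compact : compact [set: bX].
Proof.
have cptS : compact (@stone_cech_set R X).
  pose cube := [set p : cube_space R X | forall phi, `[0:R, 1]%classic (p phi)].
  apply: (@subclosed_compact _ (@stone_cech_set R X) cube).
  - exact: closed_closure.
  - apply: (@tychonoff {classic I} (fun=> R) (fun=> `[0, 1]%classic)) => phi.
    exact: segment_compact.
  - move=> p cp phi.
    have cl01 : closed `[0:R, 1]%classic by exact: itv_closed.
    apply: cl01 => B Bp.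
    have [_ [[x _ <-] Bx]] :=
      cp _ (@proj_continuous {classic I} (fun=> R) phi p _ Bp).
    by exists (sval phi x); split=> //=; rewrite in_itv/=; exact: (svalP phi).2.
move=> F PF _.
have [|p [Sp clp]] := cptS (set_val @ F : set_system (cube_space R X)).
  apply: (@filterS _ F _ setT); last exact: filterT.
  by move=> [q qS] _; exact: set_mem.
exists (exist _ p (mem_set Sp)); split=> // A B FA [_ [[V oV <-] /= Vp] VB].
have [_ [[q Aq <-] Vq]] : (set_val @` A) `&` V !=set0.
  apply: clp; last exact: open_nbhs_nbhs.
  by rewrite /fmap /=; apply: (@filterS bX F _ A) => // q Aq; exists q.
by exists q; split=> //; apply: VB.
Qed.

Lemma stone_cech_extension (phi : X -> R) : continuous phi ->
  (forall x, 0 <= phi x <= 1) ->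
  exists2 psi : bX -> R, continuous psi &
    forall x, psi (stone_cech_embed R x) = phi x.
Proof.
move=> cphi phi01; pose i : I := exist _ phi (conj cphi phi01).
exists (fun p => (set_val p : cube_space R X) i) => //.
exact: stone_cech_coord_continuous.
Qed.

Lemma stone_cech_embed_initial : completely_regular_space X ->
  forall U : set X, open U ->
  exists2 V : set bX, open V & U = (@stone_cech_embed R X) @^-1` V.
Proof.
move=> crX U oU.
exists (\bigcup_(V in [set V : set bX |
    open V /\ @stone_cech_embed R X @^-1` V `<=` U]) V).
  by apply: bigcup_open => V [].
apply/seteqP; split=> x; last by move=> [V [_ VU] Vx]; exact: VU.
move=> Ux; have : uniform_separator [set x] (~` U).
  by apply: crX => [|/=]; [exact: open_closedC|apply].
move=> /(@uniform_separatorP _ R)[phi [cphi phi01 phi0 phi1]].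
have [|psi cpsi psiE] := stone_cech_extension cphi.
  by move=> y; have := phi01 _ (ex_intro2 _ _ y Logic.I erefl); rewrite /= in_itv.
exists (psi @^-1` [set r | r < 1]) => /=; last first.
  by rewrite psiE (phi0 (phi x))//; exists x.
split; first by apply: open_comp => //; exact: open_lt.
move=> y /=; rewrite psiE => lt1; apply: contrapT => nUy.
by move: lt1; rewrite (phi1 (phi y)) ?ltxx//; exists y.
Qed.

Lemma stone_cech_embed_inj : hausdorff_space X -> completely_regular_space X ->
  injective (@stone_cech_embed R X).
Proof.
move=> hX crX x y xy; apply: hX => A B; rewrite !nbhsE => -[U [oU Ux] UA] [V [oV Vy] VB].
have [W oW UE] := stone_cech_embed_initial crX oU.
exists y; split; last exact: VB.
by apply: UA; move: Ux; rewrite UE /= xy.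
Qed.
End stone_cech_theory.

(* Main.v *)
Require Import Defs.
From HB Require Import structures.
From mathcomp Require Import all_boot all_order all_algebra.
From mathcomp Require Import all_classical all_reals all_analysis.
From mathcomp Require wochoice.
From mathcomp Require Import lra.

Import Order.TTheory GRing.Theory Num.Theory.
Import numFieldNormedType.Exports.

Set Implicit Arguments.
Unset Strict Implicit.
Unset Printing Implicit Defensive.

Local Open Scope classical_set_scope.
Local Open Scope ring_scope.

(** Let [e : X -> Y] be the embedding of [X] into its Stone-Cech
compactification; the proof uses that [Y] is compact and that every continuous
[[0, 1]]-valued function on [X] extends continuously along [e].

From an extension to fragmentation. A regular sequence pulls back along a
continuous map, so it suffices to fragment a Baire-one function [g = lim g_n] on
the compact space [Y] ([baire_one_compact_fragmented]). For [delta > 0] the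
countably many sets [{y : |g_n y - a| <= delta for all n >= N}], [a] rational,
cover [Y]; each of them is an intersection of zero sets, and [g] oscillates by
at most [2 * delta] on it. Call a set reachable if it is the last term of a
countable regular sequence (in the sense of that set) of functionally open sets
with small oscillation on the successive differences. Reachable sets are closed
under countable unions, by concatenation of sequences ([reachable_bigcup]), and
one may add to a reachable set a functionally open set on the new part of which
the oscillation is small ([reachable_add]). Hence, if [{phi > 0}] is not
reachable, then for each member [Z] of the cover there is a smaller unreachable
set [{psi > 0}] with [{psi >= 0}] inside [{phi > 0} \ Z]; otherwise
[{phi > 0} \ Z], being a countable union of such sets, would be reachable, and
then so would [{phi > 0}] ([unreachable_shrink]). If [Y] were not reachable,
running through the cover this way would give a decreasing sequence of nonempty
closed sets [{psi_n >= 0}] whose intersection misses the whole cover; this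
contradicts compactness ([compact_reachable]). It is the proof of the Baire
category theorem, with unreachable in the place of nonempty.

From fragmentation to an extension. Let [U] be a regular sequence of
functionally open sets associated with [f] and [eps], and extend to [Y] the
functions that define its terms. Mapping a point of [Y] to a constant that
depends only on the first index at which the extended function is positive gives
a Baire-one function ([baire_one_first_positive]), which is [eps]-close to [f]
on [X] when the constants are values of [f] ([fragmented_baire_one_approx]).
Applying this to [eps = 2^-1 ^+ n / 2] gives functions [h_n] that converge to
[f] uniformly on [X]. They need not converge elsewhere on [Y], so each increment
is truncated to size [2^-1 ^+ n]; this changes nothing on [X] and makes the
sequence converge uniformly on [Y] to a Baire-one function
([baire_one_extend_approx]). *)

(** * Truncation and geometrically convergent sequences *)

Section clamping.
Variable R : realType.

Definition clamp (a b x : R) : R := Num.max a (Num.min b x).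

Lemma clamp_continuous (a b : R) : continuous (clamp a b).
Proof.
move=> x; apply: (@continuous_max R R (fun=> a) (fun y => Num.min b y)).
  exact: cst_continuous.
by apply: (@continuous_min R R (fun=> b) id); [exact: cst_continuous|exact].
Qed.

Lemma clamp_itv (a b x : R) : a <= b -> a <= clamp a b x <= b.
Proof. by move=> ab; rewrite /clamp le_max lexx ge_max ab ge_min lexx. Qed.

Lemma clamp_id (a b x : R) : a <= x <= b -> clamp a b x = x.
Proof.
by move=> /andP[ax xb]; rewrite /clamp (min_idPr xb) (max_idPr ax).
Qed.

Lemma clamp_lb (a b x : R) : a <= b -> x <= a -> clamp a b x = a.
Proof.
move=> ab xa; rewrite /clamp (min_idPr (le_trans xa ab)).
exact/max_idPl.
Qed.

Lemma clamp_ub (a b x : R) : a <= b -> b <= x -> clamp a b x = b.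
Proof. by move=> ab bx; rewrite /clamp (min_idPl bx); exact/max_idPr. Qed.

Lemma clamp_gt_lb (a b x : R) : a < b -> a < x -> a < clamp a b x.
Proof. by move=> ab ax; rewrite /clamp lt_max lt_min ab ax orbT. Qed.

End clamping.

Section geometric_steps.
Variable R : realType.

Lemma half_expr_lt (e : R) : 0 < e -> exists n, 2^-1 ^+ n < e.
Proof.
move=> e0; have h : `|2^-1 : R| < 1 by rewrite ger0_norm ?invr_ge0//; lra.
have /cvgrPdist_lt/(_ _ e0)[N _ /(_ N (leqnn N)) /=] := cvg_expr h.
rewrite sub0r normrN ger0_norm ?exprn_ge0 ?invr_ge0//.
by exists N.
Qed.

Lemma half_exprS (n : nat) : 2^-1 ^+ n.+1 = 2^-1 ^+ n / 2 :> R.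
Proof. by rewrite exprSr. Qed.

Lemma half_expr_gt0 (n : nat) : 0 < 2^-1 ^+ n :> R.
Proof. by rewrite exprn_gt0 ?invr_gt0. Qed.

Lemma half_expr_homo (m n : nat) : (m <= n)%N -> 2^-1 ^+ n <= 2^-1 ^+ m :> R.
Proof. by move=> mn; rewrite ler_wiXn2l ?invr_ge0//; lra. Qed.

Lemma geometric_steps_le (u : nat -> R) (N n : nat) :
  (forall n, `|u n.+1 - u n| <= 2^-1 ^+ n) -> (N <= n)%N ->
  `|u n - u N| <= 2 * 2^-1 ^+ N - 2 * 2^-1 ^+ n.
Proof.
move=> hu /subnKC <-; elim: (n - N)%N => [|k ih].
  by rewrite addn0 !subrr normr0.
have := hu (N + k)%N; rewrite addnS half_exprS.
move: ih; rewrite !ler_norml; set a := u _.+1; set b := u (N + k)%N.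
by move=> /andP[? ?] /andP[? ?]; apply/andP; split; lra.
Qed.

(** The sequences [u n - 2 * 2^-1 ^+ n] and [u n + 2 * 2^-1 ^+ n] are
nondecreasing and nonincreasing, so that the supremum of the first is a limit
with an explicit error bound. *)
Lemma geometric_steps_limit (u : nat -> R) :
  (forall n, `|u n.+1 - u n| <= 2^-1 ^+ n) ->
  exists l, forall N, `|u N - l| <= 2 * 2^-1 ^+ N.
Proof.
move=> hu; pose E := range (fun n => u n - 2 * 2^-1 ^+ n).
have ubE N : ubound E (u N + 2 * 2^-1 ^+ N).
  move=> _ [n _ <-].
  have [nN|/ltnW Nn] := leqP n N; have := geometric_steps_le hu _.
    move=> /(_ _ _ nN); rewrite ler_norml => /andP[? ?].
    by have := (half_expr_gt0 N); lra.
  move=> /(_ _ _ Nn); rewrite ler_norml => /andP[? ?].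
  by have := (half_expr_gt0 n); lra.
exists (sup E) => N; rewrite ler_norml; apply/andP; split.
  have : sup E <= u N + 2 * 2^-1 ^+ N.
    by apply: ge_sup => //; exists (u 0%N - 2 * 2^-1 ^+ 0), 0%N.
  lra.
have : u N - 2 * 2^-1 ^+ N <= sup E.
  by apply: ub_le_sup; [exists (u 0%N + 2 * 2^-1 ^+ 0) => //; exact: ubE|exists N].
lra.
Qed.

End geometric_steps.

Section continuous_geometric_limit.
Variables (R : realType) (X : topologicalType).

Lemma continuous_geometric_limit (s : nat -> X -> R) (phi : X -> R) :
  (forall n, continuous (s n)) ->
  (forall n x, `|s n x - phi x| <= 2 * 2^-1 ^+ n) -> continuous phi.
Proof.
move=> cs hs x; apply/cvgrPdist_lt => e e0.
have [n ne] := @half_expr_lt R (e / 5) ltac:(lra).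
have /cvgrPdist_lt/(_ (e / 5) ltac:(lra)) := cs n x.
apply: filterS => y; have := hs n x; have := hs n y.
rewrite !ler_norml !ltr_norml => /andP[? ?] /andP[? ?] /andP[? ?].
by apply/andP; split; lra.
Qed.

End continuous_geometric_limit.

(** * Functionally open sets *)

Section functionally_open_theory.
Variables (R : realType) (X : topologicalType).

Lemma functionally_open_pos (phi : X -> R) :
  continuous phi -> functionally_open R [set x | 0 < phi x].
Proof.
move=> cphi; exists (clamp 0 1 \o phi).
  split; last by move=> x; exact: clamp_itv.
  move=> x; apply: continuous_comp; first exact: cphi.
  exact: clamp_continuous.
apply/seteqP; split=> x /=; rewrite in_itv/= => h.
  by rewrite clamp_gt_lb//=; have /andP[] := @clamp_itv R 0 1 (phi x) ler01.
rewrite ltNge; apply/negP => phi0; move: h.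
by rewrite clamp_lb// ltxx.
Qed.

Lemma functionally_open_open (U : set X) : functionally_open R U -> open U.
Proof.
move=> [phi [cphi phi01] ->]; rewrite (_ : _ @^-1` _ = phi @^-1` [set r | 0 < r]).
  by apply: open_comp; [move=> x _; exact: cphi|exact: open_gt].
apply/seteqP; split => x /=; rewrite in_itv/=; first by case/andP.
by move=> ->; have /andP[] := phi01 x.
Qed.

(** The series with general term [2^-1 ^+ n * phi n] converges uniformly, and its
sum is positive exactly where some [phi n] is. *)
Lemma functionally_open_bigcup (U : nat -> set X) :
  (forall n, functionally_open R (U n)) -> functionally_open R (\bigcup_n U n).
Proof.
move=> oU; have /choice[phi hphi] n : exists phi : X -> R,
    (continuous phi /\ forall x, 0 <= phi x <= 1) /\ U n = phi @^-1` `]0, 1].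
  by have [phi ? ?] := oU n; exists phi.
pose s n x := \sum_(k < n) 2^-1 ^+ k * phi k x.
have sS n x : s n.+1 x = s n x + 2^-1 ^+ n * phi n x by rewrite /s big_ord_recr.
have le01 n x : 0 <= 2^-1 ^+ n * phi n x <= 2^-1 ^+ n.
  have [[_ /(_ x)/andP[p0 p1]] _] := hphi n.
  by rewrite mulr_ge0 ?(ltW (half_expr_gt0 _ _))//= ler_piMr ?(ltW (half_expr_gt0 _ _)).
have hs x n : `|s n.+1 x - s n x| <= 2^-1 ^+ n.
  by rewrite sS addrC addKr; have /andP[? ?] := le01 n x; rewrite ger0_norm.
have /choice[l hl] x := geometric_steps_limit (hs x).
have s_le_l x n : s n x <= l x.
  apply/ler_addgt0Pr => e e0; have [m me] := @half_expr_lt R (e / 2) ltac:(lra).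
  have : s n x <= s (maxn m n) x.
    elim: (maxn m n) (leq_maxr m n) => [|k ih]; first by rewrite leqn0 => /eqP ->.
    rewrite leq_eqVlt => /predU1P[->//|/ih /le_trans]; apply.
    by rewrite sS lerDl; have /andP[] := le01 k x.
  have := hl x (maxn m n); rewrite ler_norml => /andP[? ?].
  have := @half_expr_homo R _ _ (leq_maxl m n); lra.
have s0 x : s 0%N x = 0 by rewrite /s big_ord0.
have cl : continuous l.
  apply: (@continuous_geometric_limit _ _ s) => // n.
  apply: (@continuous_big R _ +%R 0 _ add_continuous) => k _ x.
  by apply: cvgM; [exact: cvg_cst|have [[c _] _] := hphi k; exact: c].
rewrite (_ : \bigcup_n U n = [set x | 0 < l x]); first exact: functionally_open_pos.
apply/seteqP; split => x.
  move=> [n _]; have [_ ->] := hphi n; rewrite /= in_itv/= => /andP[p0 _].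
  apply: lt_le_trans (s_le_l x n.+1); rewrite sS ltr_wpDl//; last first.
    by rewrite mulr_gt0// half_expr_gt0.
  by apply: sumr_ge0 => k _; have /andP[] := le01 k x.
move=> /= l0; apply: contrapT => nU.
have p0 n : phi n x <= 0.
  rewrite leNgt; apply/negP => pn; apply: nU; exists n => //.
  by have [[_ /(_ x)/andP[_ p1]] ->] := hphi n; rewrite /= in_itv/= pn.
have sle0 n : s n x <= 0.
  by apply: sumr_le0 => k _; rewrite mulr_ge0_le0// ltW// half_expr_gt0.
have [m me] := @half_expr_lt R (l x / 2) ltac:(lra).
have := hl x m; rewrite ler_norml => /andP[? ?]; have := sle0 m; lra.
Qed.

Lemma functionally_openU (U V : set X) :
  functionally_open R U -> functionally_open R V -> functionally_open R (U `|` V).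
Proof.
move=> oU oV; rewrite (_ : U `|` V = \bigcup_n (if n is 0%N then U else V)).
  by apply: functionally_open_bigcup => -[].
apply/seteqP; split => x.
  by case=> [Ux|Vx]; [exists 0%N|exists 1%N].
by case=> -[|n] _; [left|right].
Qed.

Lemma functionally_open0 : functionally_open R (@set0 X).
Proof.
rewrite (_ : set0 = [set x : X | 0 < (0 : R)]).
  by apply: functionally_open_pos; exact: cst_continuous.
by apply/seteqP; split => x //=; rewrite ltxx.
Qed.

End functionally_open_theory.

Lemma countable_setU (T : Type) (A B : set T) :
  countable A -> countable B -> countable (A `|` B).
Proof.
move=> cA cB; rewrite -bigcup2E.
by apply: bigcup_countable => // -[|[|i]].
Qed.

(** * Well-ordered chains of functionally open sets *)

Section fragmenting_chains.
Variables (R : realType) (X : topologicalType) (f : X -> R) (delta : R).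

Definition union_below (C : set (set X)) (A : set X) : set X :=
  \bigcup_(B in [set B | C B /\ B `<` A]) B.

(** A regular sequence that ends at [V], encoded as the set of its terms: a
family of sets well-ordered by inclusion. The union of the terms strictly below
a term [A] is the predecessor of [A] if [A] is a successor, and is [A] itself if
[A] is a limit. Thus [chain_small] bounds the oscillation of [f] on successive
differences, and [chain_below] expresses continuity at limit terms: if the union
differs from [A], it is a term, and then the predecessor of [A]. *)
Record fragmenting_chain (C : set (set X)) (V : set X) : Prop := {
  chain_countable : countable C;
  chain_functionally_open : forall A, C A -> functionally_open R A;
  chain_top : C V;
  chain_le_top : forall A, C A -> A `<=` V;
  chain_least : forall E, E `<=` C -> E !=set0 ->
    exists2 A, E A & forall B, E B -> A `<=` B;
  chain_below : forall A, C A -> C (union_below C A);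
  chain_small : forall A, C A -> forall x y,
    (A `\` union_below C A) x -> (A `\` union_below C A) y ->
    `|f x - f y| <= delta }.

Definition reachable (V : set X) : Prop := exists C, fragmenting_chain C V.

Lemma union_below_sub (C : set (set X)) (A : set X) : union_below C A `<=` A.
Proof. by move=> x [B [_ [BA _]]]; exact: BA. Qed.

Lemma union_below_sup (C : set (set X)) (A B : set X) :
  C B -> B `<=` A -> B <> A -> B `<=` union_below C A.
Proof.
move=> CB BA nBA x Bx; exists B => //; split=> //; split=> // AB.
by apply: nBA; apply/seteqP.
Qed.

Lemma chain_total (C : set (set X)) (V A B : set X) :
  fragmenting_chain C V -> C A -> C B -> A `<=` B \/ B `<=` A.
Proof.
move=> hC CA CB.
have [||D [->|->] h] := chain_least hC (E := [set D | D = A \/ D = B]).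
- by move=> _ [->|->].
- by exists A; left.
- by left; apply: h; right.
- by right; apply: h; left.
Qed.

(** The empty set is the union of the terms strictly below the least one. *)
Lemma chain_set0 (C : set (set X)) (V : set X) :
  fragmenting_chain C V -> C set0.
Proof.
move=> hC; have [|A CA h] := chain_least hC (fun _ => id).
  by exists V; exact: chain_top hC.
rewrite (_ : set0 = union_below C A); first exact: chain_below hC _ CA.
by apply/seteqP; split => // x [B [CB [_ nAB]] _]; case: nAB; exact: h.
Qed.

Lemma reachable0 : reachable set0.
Proof.
exists [set set0]; split => //.
- by move=> _ ->; exact: functionally_open0.
- by move=> _ ->.
- move=> E sE [A EA]; exists A => // B /sE ->; have -> := sE _ EA.
  exact: sub0set.
- by move=> _ ->; apply/seteqP; split => // x [_ [-> _]].
- by move=> _ -> x y [].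
Qed.

Lemma reachable_add (V O : set X) : reachable V -> functionally_open R O ->
  (forall x y, (O `\` V) x -> (O `\` V) y -> `|f x - f y| <= delta) ->
  reachable (V `|` O).
Proof.
move=> [C hC] oO sO.
have [OV|nOV] := pselect (O `<=` V); first by exists C; rewrite setUidl.
pose C' := C `|` [set V `|` O].
have belowC A : C A -> union_below C' A = union_below C A.
  move=> CA; apply/seteqP; split => x [B [CB BA] Bx]; last first.
    by exists B => //; split => //; left.
  exists B => //; split => //; case: CB => // BE; exfalso; apply: nOV.
  apply: subset_trans (chain_le_top hC CA); apply: subset_trans BA.1.
  by rewrite BE; exact: subsetUr.
have belowT : union_below C' (V `|` O) = V.
  apply/seteqP; split.
    move=> x [B [[CB _|-> []//] Bx]]; exact: chain_le_top hC _ CB _ Bx.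
  apply: union_below_sup; first by left; exact: chain_top hC.
    exact: subsetUl.
  by move=> VE; apply: nOV; rewrite VE; exact: subsetUr.
exists C'; split.
- by apply: countable_setU; [exact: chain_countable hC|exact: countable1].
- move=> A [/(chain_functionally_open hC)//|->].
  apply: functionally_openU => //.
  exact: (chain_functionally_open hC (chain_top hC)).
- by right.
- move=> A [/(chain_le_top hC) h|->//]; exact: subset_trans h (@subsetUl _ _ _).
- move=> E EC' [A EA]; have [[B [EB CB]]|nE] := pselect (exists B, E B /\ C B).
    have [|D [ED CD] hD] := chain_least hC (E := E `&` C) (@subIsetr _ _ _).
      by exists B.
    exists D => // G EG; have [CG|->] := EC' _ EG; first by apply: hD; split.
    exact: subset_trans (chain_le_top hC CD) (@subsetUl _ _ _).
  have EE B : E B -> B = V `|` O.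
    by move=> EB; have [CB|//] := EC' _ EB; exfalso; apply: nE; exists B.
  by exists A => // B /EE ->; rewrite (EE _ EA).
- move=> A [CA|->]; first by rewrite belowC//; left; exact: chain_below hC _ CA.
  by rewrite belowT; left; exact: chain_top hC.
- move=> A [CA|->].
    by rewrite belowC//; exact: chain_small hC _ CA.
  move=> x y; rewrite belowT => -[[//|Ox] nVx] [[//|Oy] nVy].
  exact: sO.
Qed.

(** Concatenation: after the chain of [V 0], whose last term is [S 1 = V 0],
come the unions of [S 1] with the terms of the chain of [V 1], which end at
[S 2], and so on; the whole union is put at the end. Enlarging all the terms of
a chain by the same set can only make successive differences smaller. *)
Lemma reachable_bigcup (V : nat -> set X) :
  (forall n, reachable (V n)) -> reachable (\bigcup_n V n).
Proof.
move=> /choice[C hC].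
pose S n := \bigcup_(i in `I_n) V i.
have SS n : S n.+1 = S n `|` V n.
  by rewrite /S bigcup_mkord big_ord_recr/= -bigcup_mkord.
have S_homo m n : (m <= n)%N -> S m `<=` S n.
  by move=> mn x [i im Vx]; exists i => //; exact: leq_trans im mn.
have S_sub n : S n `<=` \bigcup_n V n by move=> x [i _ Vx]; exists i.
pose D n := [set S n `|` A | A in C n].
have D_lb n A : D n A -> S n `<=` A by move=> [B _ <-]; exact: subsetUl.
have D_ub n A : D n A -> A `<=` S n.+1.
  move=> [B CB <-]; rewrite SS; apply: setUS; exact: chain_le_top (hC n) _ CB.
have DS n : D n (S n).
  by exists set0; [exact: chain_set0 (hC n)|rewrite setU0].
have DSS n : D n (S n.+1).
  by exists (V n); [exact: chain_top (hC n)|rewrite SS].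
pose C' := (\bigcup_n D n) `|` [set \bigcup_n V n].
have C'_sub A : C' A -> A `<=` \bigcup_n V n.
  by move=> [[n _ /D_ub h]|->//]; exact: subset_trans h (S_sub _).
(* Different pairs (n, B) may give the same set A = S n `|` B. With n least, and
   then B least, the terms of the new chain strictly below A come from the terms
   of C n strictly below B; for n > 0, S n itself is strictly below A, because
   S n is already the last term of the block D (n - 1). *)
have normal_form A : (\bigcup_n D n) A -> exists n B,
    [/\ C n B, A = S n `|` B & union_below C' A = S n `|` union_below (C n) B].
  move=> [k0 _ Dk0].
  have exD : exists k, `[< D k A >] by exists k0; apply/asboolP.
  case: (ex_minnP exD) => n /asboolP DnA n_min.
  have [||B [CB AE] B_min] := chain_least (hC n)
    (E := [set B | C n B /\ A = S n `|` B]).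
  - by move=> B [].
  - by case: DnA => B CB AE; exists B.
  exists n, B; split=> //; apply/seteqP; split.
    move=> x [A' [[[m _ DmA']|->] [A'A nAA']] A'x]; last first.
      exfalso; apply: nAA'; rewrite AE; apply: subset_trans (S_sub n.+1).
      by rewrite -AE; exact: D_ub.
    have [mn|nm|mn] := ltngtP m n.
    - by left; apply: S_homo mn _ _; exact: D_ub DmA' _ A'x.
    - exfalso; apply: nAA'; apply: subset_trans (D_lb _ _ DmA').
      by apply: subset_trans (S_homo _ _ nm); exact: D_ub.
    - move: DmA'; rewrite mn => -[B' CB' A'E]; move: A'x; rewrite -A'E.
      case=> [|B'x]; first by left.
      right; exists B' => //; split=> //.
      have nBB' : ~ (B `<=` B').
        by move=> BB'; apply: nAA'; rewrite AE -A'E; exact: setUS.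
      by split=> //; have [//|] := chain_total (hC n) CB' CB.
  rewrite subUset; split.
    have [SA|nSA] := pselect (S n = A); last first.
      by apply: union_below_sup => //; [left; exists n|exact: D_lb].
    case: n => [|n] in DnA n_min B_min CB AE SA *; first by move=> x [].
    suff : (n.+1 <= n)%N by rewrite ltnn.
    by apply: n_min; apply/asboolP; rewrite -SA.
  move=> x [B' [CB' [B'B nBB']] B'x].
  have B'A : S n `|` B' <> A.
    by move=> B'E; apply: nBB'; apply: B_min; split=> //; rewrite B'E.
  apply: (@union_below_sup C' A (S n `|` B')) => //; last by right.
    by left; exists n => //; exists B'.
  by rewrite AE; exact: setUS.
have top_below : ~ (\bigcup_n D n) (\bigcup_n V n) ->
    union_below C' (\bigcup_n V n) = \bigcup_n V n.
  move=> nD; apply/seteqP; split; first exact: union_below_sub.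
  move=> x [n _ Vx]; apply: (@union_below_sup C' _ (S n.+1)).
  - by left; exists n.
  - exact: S_sub.
  - by move=> SE; apply: nD; exists n => //; rewrite -SE.
  - by rewrite SS; right.
exists C'; split.
- apply: countable_setU; last exact: countable1.
  apply: bigcup_countable => // n _.
  exact: sub_countable (card_image_le _ _) (chain_countable (hC n)).
- have oV n : functionally_open R (V n).
    exact: (chain_functionally_open (hC n) (chain_top (hC n))).
  have oS n : functionally_open R (S n).
    elim: n => [|n ih].
      by rewrite /S II0 bigcup_set0; exact: functionally_open0.
    by rewrite SS; exact: functionally_openU.
  move=> A [[n _ [B CB <-]]|->]; last exact: functionally_open_bigcup.
  by apply: functionally_openU => //; exact: (chain_functionally_open (hC n) CB).
- by right.
- exact: C'_sub.
- move=> E EC' [A EA].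
  have [[n0 [B0 [EB0 DB0]]]|nE] := pselect (exists n B, E B /\ D n B); last first.
    have EE B : E B -> B = \bigcup_n V n.
      by move=> EB; have [[n _ DB]|//] := EC' _ EB; exfalso; apply: nE; exists n, B.
    by exists A => // B /EE ->; rewrite (EE _ EA).
  have exn : exists n, `[< exists B, E B /\ D n B >].
    by exists n0; apply/asboolP; exists B0.
  case: (ex_minnP exn) => n /asboolP[B [EB [G CG GE]]] n_min.
  have [||H [CH EH] H_min] := chain_least (hC n)
    (E := [set H | C n H /\ E (S n `|` H)]).
  - by move=> H [].
  - by exists G; split=> //; rewrite GE.
  exists (S n `|` H) => // K EK; have DH : D n (S n `|` H) by exists H.
  have [[m _ DmK]|->] := EC' _ EK; last by apply: C'_sub; left; exists n.
  have [mn|nm|mn] := ltngtP m n.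
  + suff : (n <= m)%N by rewrite leqNgt mn.
    by apply: n_min; apply/asboolP; exists K.
  + apply: subset_trans (D_lb _ _ DmK); apply: subset_trans (S_homo _ _ nm).
    exact: D_ub.
  + move: DmK; rewrite mn => -[K' CK' K'E]; rewrite -K'E; apply: setUS.
    by apply: H_min; split=> //; rewrite K'E.
- move=> A CA; have [DA|nDA] := pselect ((\bigcup_n D n) A).
    have [n [B [CB _ ->]]] := normal_form _ DA.
    left; exists n => //; exists (union_below (C n) B) => //.
    exact: chain_below (hC n) _ CB.
  by case: CA => [//|AE]; rewrite AE in nDA *; rewrite top_below//; right.
- move=> A CA; have [DA|nDA] := pselect ((\bigcup_n D n) A); last first.
    case: CA => [//|AE]; rewrite AE in nDA *; rewrite top_below// => x y [].
    by move=> Vx /(_ Vx).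
  have [n [B [CB -> ->]]] := normal_form _ DA => x y.
  move=> [[Sx|Bx] nx]; first by exfalso; apply: nx; left.
  move=> [[Sy|By] ny]; first by exfalso; apply: ny; left.
  apply: (chain_small (hC n) CB); split=> // ?.
    by apply: nx; right.
  by apply: ny; right.
Qed.

End fragmenting_chains.

(** * From chains to regular sequences *)

Section ordinal_of_chain.
Variables (R : realType) (X : topologicalType) (f : X -> R) (delta : R).
Variables (C : set (set X)) (hC : fragmenting_chain f delta C setT).

(** The terms of a chain, ordered by inclusion, as an ordinal interval. The chain
property is an argument because the order is total, and has its two bounds, only
by virtue of it. *)
Definition chain_ordinal of fragmenting_chain f delta C setT : Type :=
  {A : set X | C A}.
Local Notation W := (chain_ordinal hC).

Definition chain_ordinal_set (A : W) : set X := sval A.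

Definition chain_ordinal_le (A B : W) :=
  `[< chain_ordinal_set A `<=` chain_ordinal_set B >].

Lemma chain_ordinal_le_refl : reflexive chain_ordinal_le.
Proof. by move=> A; apply/asboolP. Qed.

Lemma chain_ordinal_le_anti : antisymmetric chain_ordinal_le.
Proof.
move=> [A CA] [B CB] /andP[/asboolP AB /asboolP BA].
by apply: eq_exist; apply/seteqP.
Qed.

Lemma chain_ordinal_le_trans : transitive chain_ordinal_le.
Proof.
move=> B A D /asboolP AB /asboolP BD; apply/asboolP.
exact: subset_trans BD.
Qed.

Lemma chain_ordinal_le_total : total chain_ordinal_le.
Proof.
move=> A B; apply/orP.
by have [AB|BA] := chain_total hC (svalP A) (svalP B); [left|right]; apply/asboolP.
Qed.

Definition chain_ordinal_bot : W := exist _ set0 (chain_set0 hC).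
Definition chain_ordinal_top : W := exist _ setT (chain_top hC).

Lemma chain_ordinal_bot_le A : chain_ordinal_le chain_ordinal_bot A.
Proof. by apply/asboolP; exact: sub0set. Qed.

Lemma chain_ordinal_le_top A : chain_ordinal_le A chain_ordinal_top.
Proof. by apply/asboolP; exact: subsetT. Qed.

HB.instance Definition _ := gen_eqMixin W.
HB.instance Definition _ := gen_choiceMixin W.
HB.instance Definition _ := Order.Le_isPOrder.Build (Order.Disp tt tt) W
  chain_ordinal_le_refl chain_ordinal_le_anti chain_ordinal_le_trans.
HB.instance Definition _ :=
  Order.POrder_isTotal.Build (Order.Disp tt tt) W chain_ordinal_le_total.
HB.instance Definition _ :=
  Order.hasBottom.Build (Order.Disp tt tt) W chain_ordinal_bot_le.
HB.instance Definition _ :=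
  Order.hasTop.Build (Order.Disp tt tt) W chain_ordinal_le_top.

Lemma chain_ordinal_leP (A B : W) :
  reflect (chain_ordinal_set A `<=` chain_ordinal_set B) (A <= B)%O.
Proof. exact: asboolP. Qed.

Lemma chain_ordinal_ltP (A B : W) :
  reflect (chain_ordinal_set A `<` chain_ordinal_set B) (A < B)%O.
Proof.
rewrite lt_leAnge; apply: (iffP andP) => -[AB nBA].
  split; first exact/chain_ordinal_leP.
  by move=> BA; move/negP: nBA; apply; apply/chain_ordinal_leP.
by split; [exact/chain_ordinal_leP|apply/negP => /chain_ordinal_leP].
Qed.

Lemma chain_ordinal_well_order : wochoice.well_order (<=%O : rel W).
Proof.
apply: wochoice.antisymmetric_well_order; first exact: chain_ordinal_le_anti.
move=> E [A EA].
have [||_ [B EB <-] B_min] := chain_least hC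
  (E := [set sval B | B in [set B | B \in E]]).
- by move=> _ [B _ <-]; exact: svalP.
- by exists (sval A), A.
exists B; split=> // D ED; apply/chain_ordinal_leP; apply: B_min.
by exists D.
Qed.

Lemma chain_ordinal_countable : countable [set: W].
Proof.
apply: sub_countable (chain_countable hC).
have -> : [set: W] = chain_ordinal_set @^-1` C.
  by apply/seteqP; split=> // A _; exact: (svalP A).
apply: card_ge_preimage => -[A CA] [B CB] _ _; exact: eq_exist.
Qed.

Lemma chain_ordinal_below (A : W) : union_below C (chain_ordinal_set A) =
  \bigcup_(B in [set B : W | (B < A)%O]) chain_ordinal_set B.
Proof.
apply/seteqP; split => x [B].
  move=> [CB BA] Bx; exists (exist _ B CB : W) => //=.
  exact/chain_ordinal_ltP.
move=> /= /chain_ordinal_ltP BA Bx; exists (chain_ordinal_set B) => //.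
by split=> //; exact: (svalP B).
Qed.

Lemma chain_ordinal_successor (A B : W) : successor_of A B ->
  union_below C (chain_ordinal_set B) = chain_ordinal_set A.
Proof.
move=> [AB A_max]; rewrite chain_ordinal_below; apply/seteqP; split.
  move=> x [D /= DB]; apply/chain_ordinal_leP.
  by rewrite leNgt; apply/negP => /A_max; rewrite leNgt DB.
by move=> x Ax; exists A.
Qed.

Lemma chain_ordinal_limit (A : W) : limit_ordinal A ->
  union_below C (chain_ordinal_set A) = chain_ordinal_set A.
Proof.
move=> [_ A_lim]; apply: contrapT => PA.
pose P : W := exist _ (union_below C (chain_ordinal_set A)) (chain_below hC (svalP A)).
have PltA : (P < A)%O.
  rewrite lt_neqAle; apply/andP; split.
    by apply/eqP => PE; apply: PA; rewrite -[in RHS]PE.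
  by apply/chain_ordinal_leP; exact: union_below_sub.
apply: (A_lim P); split=> // B PB; rewrite leNgt; apply/negP => BA.
move: PB; rewrite ltNge => /negP; apply; apply/chain_ordinal_leP => x Bx.
rewrite /chain_ordinal_set/= chain_ordinal_below.
by exists B.
Qed.

Lemma chain_eps_countably_fragmented (eps : R) : 0 <= delta < eps ->
  functionally_eps_countably_fragmented eps f.
Proof.
move=> /andP[delta0 deltaeps].
exists (Order.Disp tt tt), W, chain_ordinal_set; split.
- exact: chain_ordinal_well_order.
- exact: chain_ordinal_countable.
- split; first split=> //.
  + move=> A; exact: (functionally_open_open (chain_functionally_open hC (svalP A))).
  + by move=> A B AB; apply/chain_ordinal_leP.
  + by move=> A A_lim; rewrite -chain_ordinal_below chain_ordinal_limit.
  move=> A B AB; apply: (@le_lt_trans _ _ delta%:E); last by rewrite lte_fin.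
  apply: ge_ereal_sup => r [->|]; first by rewrite lee_fin.
  move=> [_ [x [Bx nAx] <-]] [_ [y [By nAy] <-]] <-; rewrite lee_fin.
  rewrite -(chain_ordinal_successor AB) in nAx nAy.
  exact: (chain_small hC (svalP B) (conj Bx nAx) (conj By nAy)).
- by move=> A; exact: (chain_functionally_open hC (svalP A)).
Qed.

End ordinal_of_chain.

(** * Fragmentation of Baire-one functions on compact spaces *)

Section pullback.
Variables (R : realType) (X Y : topologicalType).

Lemma eps_countably_fragmented_comp (e : X -> Y) (g : Y -> R) (eps : R) :
  continuous e -> functionally_eps_countably_fragmented eps g ->
  functionally_eps_countably_fragmented eps (g \o e).
Proof.
move=> ce [d [W [U [woW cW [[oU mU U0 UT limU] sU] foU]]]].
have foe xi : functionally_open R (e @^-1` U xi).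
  have [phi [cphi phi01] ->] := foU xi; exists (phi \o e) => //.
  split=> [x|x]; last exact: phi01.
  by apply: continuous_comp; [exact: ce|exact: cphi].
exists d, W, (fun xi => e @^-1` U xi); split => //; split; first split.
- by move=> xi; exact: functionally_open_open.
- by move=> xi eta /mU UU x; exact: UU.
- by rewrite U0.
- by rewrite UT.
- by move=> gamma /limU ->; rewrite preimage_bigcup.
move=> xi eta /sU; apply: le_lt_trans; apply: ereal_sup_le.
move=> r [->|[_ [x [Ux nUx] <-]] [_ [y [Uy nUy] <-]] <-]; first by left.
by right; exists (g (e x)); [exists (e x)|exists (g (e y)); [exists (e y)|]].
Qed.

End pullback.

Section compact_fragmentation.
Variables (R : realType) (K : topologicalType).

Lemma compact_nested_nonneg (phi : nat -> K -> R) : compact [set: K] ->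
  (forall n, continuous (phi n)) ->
  (forall n x, 0 <= phi n.+1 x -> 0 <= phi n x) ->
  (forall n, exists x, 0 <= phi n x) ->
  exists p, forall n, 0 <= phi n p.
Proof.
move=> cK cphi nested /choice[x hx].
have [|p [_ clp]] := cK (x @ \oo) _; first exact: filterT.
exists p => n.
have closed_n : closed [set y | 0 <= phi n y].
  apply: (@closed_comp _ _ (phi n) [set r | 0 <= r]) => [y _|].
    exact: cphi.
  exact: closed_ge.
apply: closed_n => B pB; apply: clp => //; exists n => // m /= /subnKC <-.
have := hx (n + (m - n))%N; move: (x _) => y.
by elim: (m - n)%N => [|k ih]; rewrite ?addn0// addnS => /nested.
Qed.

Variables (f : K -> R) (delta : R).

(** The part of [{phi > 0}] outside [{x : u i x <= 0 for all i}] is the union over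
[i] and [k] of the sets where [min (phi, u i) - 2^-1 ^+ k > 0]. If all of these
were reachable, so would be their union, and then [{phi > 0}], since [f] has
small oscillation on the rest of it. The shift by [2^-1 ^+ k] makes room for the
closed set [{psi >= 0}] inside the given set. *)
Lemma unreachable_shrink (u : nat -> K -> R) (phi : K -> R) :
  (forall i, continuous (u i)) ->
  (forall x y, (forall i, u i x <= 0) -> (forall i, u i y <= 0) ->
    `|f x - f y| <= delta) ->
  continuous phi -> ~ reachable f delta [set x | 0 < phi x] ->
  exists2 psi : K -> R,
    continuous psi /\ ~ reachable f delta [set x | 0 < psi x] &
    forall x, 0 <= psi x -> 0 < phi x /\ exists i, 0 < u i x.
Proof.
move=> cu su cphi nphi; apply: contrapT => no_psi; apply: nphi.
pose psi i k x := Num.min (phi x) (u i x) - 2^-1 ^+ k.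
have cpsi i k : continuous (psi i k).
  move=> x; apply: cvgB; last exact: cvg_cst.
  by apply: (@continuous_min R K phi (u i)); [exact: cphi|exact: cu].
have rpsi i k : reachable f delta [set x | 0 < psi i k x].
  apply: contrapT => nr; apply: no_psi; exists (psi i k) => //.
  move=> x; rewrite subr_ge0 le_min => /andP[hphi hu].
  have := half_expr_gt0 R k => k0; split; first exact: lt_le_trans hphi.
  by exists i; exact: lt_le_trans hu.
pose V := \bigcup_i \bigcup_k [set x | 0 < psi i k x].
have VE x : V x <-> 0 < phi x /\ exists i, 0 < u i x.
  split.
    move=> [i _ [k _ /=]]; rewrite subr_gt0 lt_min => /andP[hphi hu].
    have k0 := half_expr_gt0 R k; split; first exact: lt_trans hphi.
    by exists i; exact: lt_trans hu.
  move=> [phi0 [i u0]]; have [|k hk] := @half_expr_lt R (Num.min (phi x) (u i x)).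
    by rewrite lt_min phi0.
  by exists i => //; exists k => //=; rewrite subr_gt0.
rewrite (_ : [set x | 0 < phi x] = V `|` [set x | 0 < phi x]); last first.
  by apply/seteqP; split => [x|x []//]; [right|case/VE].
apply: reachable_add.
- by apply: reachable_bigcup => i; exact: reachable_bigcup.
- exact: functionally_open_pos.
- have nV x : 0 < phi x -> ~ V x -> forall i, u i x <= 0.
    move=> phi0 nVx i; rewrite leNgt; apply/negP => u0; apply: nVx.
    by apply/VE; split=> //; exists i.
  by move=> x y [/= px /(nV _ px) zx] [/= py /(nV _ py) zy]; exact: su.
Qed.

(** If [K] were not reachable, iterating [unreachable_shrink] would give closed
sets [{psi_n >= 0}], decreasing, and nonempty because the empty set is reachable,
such that [{psi_(j+1) >= 0}] avoids the [j]-th member of the cover. By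
compactness they have a common point, which the cover would then miss. *)
Lemma compact_reachable (u : nat -> nat -> K -> R) : compact [set: K] ->
  0 <= delta ->
  (forall j i, continuous (u j i)) ->
  (forall j x y, (forall i, u j i x <= 0) -> (forall i, u j i y <= 0) ->
    `|f x - f y| <= delta) ->
  (forall x, exists j, forall i, u j i x <= 0) ->
  reachable f delta [set: K].
Proof.
move=> cK delta0 cu su cover; apply: contrapT => nK.
pose T := {psi : K -> R |
  continuous psi /\ ~ reachable f delta [set x | 0 < psi x]}.
have /choice[next nextP] (jt : nat * T) : exists t : T, forall x, 0 <= sval t x ->
    0 < sval jt.2 x /\ exists i, 0 < u jt.1 i x.
  case: jt => j [phi [cphi nphi]] /=.
  have [psi hpsi psiP] := unreachable_shrink (cu j) (su j) cphi nphi.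
  by exists (exist _ psi hpsi).
have one_T : continuous (fun _ : K => 1 : R) /\
    ~ reachable f delta [set x : K | 0 < (1 : R)].
  split; first exact: cst_continuous.
  rewrite (_ : [set x : K | _] = [set: K])//.
  by apply/seteqP; split => x //= _; exact: ltr01.
pose fix t n : T := if n is m.+1 then next (m, t m) else exist _ _ one_T.
have [|||p hp] := @compact_nested_nonneg (fun n => sval (t n)) cK.
- by move=> n; have [] := svalP (t n).
- by move=> n x /nextP[/ltW].
- move=> n; apply: contrapT => nx; have [_] := svalP (t n); apply.
  rewrite (_ : [set x | _] = set0); first exact: reachable0.
  by apply/seteqP; split => // x /ltW x0; apply: nx; exists x.
have [j pj] := cover p.
by have [_ [i]] := nextP (j, t j) p (hp j.+1); rewrite ltNge pj.
Qed.

End compact_fragmentation.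

Lemma baire_one_compact_fragmented (R : realType) (K : topologicalType) (g : K -> R) :
  compact [set: K] -> baire_one g -> functionally_countably_fragmented g.
Proof.
move=> cK [g_ cg g_lim] eps eps0; pose delta := eps / 4.
have delta0 : 0 < delta by rewrite /delta; lra.
(* The j-th member of the cover is the set of x with
   `|g_ n x - a| <= delta for all n >= N, where c j = (a, N). *)
pose c j : rat * nat := odflt (0, 0%N) (unpickle j).
pose u j i (x : K) := `|g_ ((c j).2 + i)%N x - ratr (c j).1| - delta.
have [||||C hC] := @compact_reachable R K g (2 * delta) u cK.
- by rewrite mulr_ge0// ltW.
- move=> j i x; apply: cvgB; last exact: cvg_cst.
  by apply: cvg_norm; apply: cvgB; [exact: cg|exact: cvg_cst].
- move=> j.
  have near_c x : (forall i, u j i x <= 0) -> `|g x - ratr (c j).1| <= delta.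
    move=> hx; apply/ler_addgt0Pr => e e0.
    have /cvgrPdist_lt/(_ _ e0)[N _ /(_ ((c j).2 + N)%N (leq_addl _ _)) /=] := g_lim x.
    have := hx N; rewrite /u; set a := g_ _ x; set b := ratr _.
    rewrite subr_le0 !ler_norml ltr_norml => /andP[? ?] /andP[? ?].
    by apply/andP; split; lra.
  move=> x y /near_c + /near_c; rewrite !ler_norml => /andP[? ?] /andP[? ?].
  by apply/andP; split; lra.
- move=> x.
  have [q] := @rat_in_itvoo R (g x - delta / 2) (g x + delta / 2) ltac:(lra).
  rewrite in_itv/= => /andP[q1 q2].
  have /cvgrPdist_lt/(_ (delta / 2) ltac:(lra))[N _ hN] := g_lim x.
  exists (pickle (q, N)) => i; rewrite /u /c pickleK/= subr_le0.
  have := hN (N + i)%N (leq_addr _ _); rewrite /= ltr_norml ler_norml.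
  by move=> /andP[? ?]; apply/andP; split; lra.
apply: (chain_eps_countably_fragmented hC).
by rewrite /delta; apply/andP; split; lra.
Qed.

(** * Extension of fragmented functions *)

Section first_positive_index.
Variables (R : realType) (K : topologicalType).
Variables (d : Order.disp_t) (W : orderType d).

(** Truncate [n * psi xi] to [[0, 1]] and call the result [t n xi]. The continuous
functions [h_ n = \sum_xi c xi * t n xi * \prod_(eta < xi) (1 - t n eta)], the sum
and the product being taken over the indices with code less than [n], are
eventually constant at each point. Indeed, if [xi] is the first index with
[psi xi x > 0], then [t n eta x = 0] for [eta < xi], while [t n xi x = 1] for
large [n]: the terms of index less than [xi] vanish, that of index [xi] is
[c xi], and every later one contains the factor [1 - t n xi x = 0]. *)
Lemma baire_one_first_positive (psi : W -> K -> R) (c : W -> R) :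
  wochoice.well_order (<=%O : rel W) -> countable [set: W] ->
  (forall xi, continuous (psi xi)) ->
  exists2 h : K -> R, baire_one h &
    forall x xi, 0 < psi xi x -> (forall eta, (eta < xi)%O -> psi eta x <= 0) ->
      h x = c xi.
Proof.
move=> woW /countable_injP[code code_inj] cpsi.
have {}code_inj : injective code.
  by move=> a b; apply: code_inj; rewrite in_setT.
have /choice[dec decP] k : exists o : option W,
    forall xi, o = Some xi <-> code xi = k.
  have [[xi xik]|nk] := pselect (exists xi, code xi = k).
    exists (Some xi) => eta; split=> [[<-]//|etak].
    by congr Some; apply: code_inj; rewrite xik etak.
  by exists None => xi; split=> // xik; case: nk; exists xi.
have codeK xi : dec (code xi) = Some xi by apply/decP.
pose lt j k := if dec j is Some a then if dec k is Some b then (a < b)%O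
  else false else false.
pose t n k x := if dec k is Some xi then clamp 0 1 (n%:R * psi xi x) else 0.
pose h_ n x := \sum_(k < n) oapp c 0 (dec k) * t n k x *
  \prod_(j < n | lt j k) (1 - t n j x).
have ct n k : continuous (t n k).
  rewrite /t; case: (dec k) => [xi|]; last exact: cst_continuous.
  move=> x; apply: (@continuous_comp _ _ _ (fun x => n%:R * psi xi x) (clamp 0 1)).
    by apply: cvgM; [exact: cvg_cst|exact: cpsi].
  exact: clamp_continuous.
have ch n : continuous (h_ n).
  apply: (@continuous_big R _ +%R 0 _ add_continuous) => k _ x.
  apply: cvgM.
    by apply: cvgM; [exact: cvg_cst|exact: ct].
  apply: (@continuous_big R _ *%R 1 _ mul_continuous) => j _ y.
  by apply: cvgB; [exact: cvg_cst|exact: ct].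
have t0 n x xi : psi xi x <= 0 -> clamp 0 1 (n%:R * psi xi x) = 0.
  by move=> px; apply: clamp_lb => //; rewrite mulr_ge0_le0.
have h_first x xi : 0 < psi xi x ->
    (forall eta, (eta < xi)%O -> psi eta x <= 0) -> h_ n x @[n --> \oo] --> c xi.
  move=> xi_pos xi_first; apply: cvg_near_cst.
  exists (maxn (code xi).+1 (Num.bound (psi xi x)^-1)) => // n /=.
  rewrite geq_max => /andP[code_n bound_n].
  have t1 : clamp 0 1 (n%:R * psi xi x) = 1.
    apply: clamp_ub => //; rewrite -ler_pdivrMr// div1r.
    apply: ltW; apply: (lt_le_trans (archi_boundP _)); last by rewrite ler_nat.
    by rewrite invr_ge0 ltW.
  rewrite /h_ (bigD1 (Ordinal code_n))//= codeK/= /t codeK t1 mulr1.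
  rewrite [X in _ * X]big1 ?mulr1; last first.
    move=> j; rewrite /lt codeK; case: (dec j) => // eta /xi_first eta0.
    by rewrite t0// subr0.
  rewrite big1 ?addr0// => k k_xi.
  case dec_k: (dec k) => [eta|]; last by rewrite mulr0 mul0r.
  have [/xi_first eta0|xi_eta|eta_xi] := ltgtP eta xi.
  - by rewrite t0// mulr0 mul0r.
  - rewrite (bigD1 (Ordinal code_n))/=; last by rewrite /lt codeK dec_k.
    by rewrite codeK t1 subrr mul0r mulr0.
  - move/decP: dec_k; rewrite eta_xi => xik.
    by move: k_xi; rewrite -val_eqE/= xik eqxx.
have /choice[h hP] x : exists l, (h_ n x @[n --> \oo] --> l) /\
    forall xi, 0 < psi xi x ->
      (forall eta, (eta < xi)%O -> psi eta x <= 0) -> l = c xi.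
  have [[xi [xi_pos xi_first]]|none] := pselect (exists xi, 0 < psi xi x /\
      (forall eta, (eta < xi)%O -> psi eta x <= 0)).
    exists (c xi); split; first exact: h_first.
    move=> eta eta_pos eta_first; congr c.
    by have [/eta_first|/xi_first|//] := ltgtP xi eta; rewrite leNgt ?xi_pos ?eta_pos.
  have all0 xi : psi xi x <= 0.
    rewrite leNgt; apply/negP => xi_pos; apply: none.
    have [|eta [[eta_in eta_min] _]] := woW [pred eta | 0 < psi eta x].
      by exists xi.
    exists eta; split=> // zeta zeta_eta; rewrite leNgt; apply/negP => zeta_pos.
    by have := eta_min zeta zeta_pos; rewrite leNgt zeta_eta.
  exists 0; split; last by move=> xi; rewrite ltNge all0.
  apply: cvg_near_cst; apply: nearW => n; rewrite /h_ big1// => k _.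
  by rewrite /t; case: (dec k) => [xi|]; rewrite ?t0// mulr0 mul0r.
exists h; last by move=> x xi; have [_] := hP x; exact.
by exists h_ => // x; have [] := hP x.
Qed.

End first_positive_index.

Section extension.
Variables (R : realType) (X Y : topologicalType) (e : X -> Y).

(** The first index [xi] with [x] in [U xi] is neither the least element nor a
limit, hence is the successor of some [eta]. The points with the same first
index lie in [U xi `\` U eta], where [f] oscillates by less than [eps], and so a
value of [f] at any one of them serves as the constant attached to [xi]. *)
Lemma fragmented_baire_one_approx (f : X -> R) (eps : R) :
  (forall phi : X -> R, continuous phi -> (forall x, 0 <= phi x <= 1) ->
    exists2 psi : Y -> R, continuous psi & forall x, psi (e x) = phi x) ->
  functionally_eps_countably_fragmented eps f ->
  exists2 h : Y -> R, baire_one h & forall x, `|h (e x) - f x| < eps.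
Proof.
move=> ext [d [W [U [woW cW [[_ _ U0 UT limU] sU] foU]]]].
have /choice[psi psiP] xi : exists psi : Y -> R, continuous psi /\
    forall x, 0 < psi (e x) <-> U xi x.
  have [phi [cphi phi01] UE] := foU xi; have [psi cpsi psiE] := ext phi cphi phi01.
  exists psi; split=> // x; rewrite psiE UE /= in_itv/=.
  by have /andP[_ ->] := phi01 x; rewrite andbT.
pose enters x xi := U xi x /\ forall eta, (eta < xi)%O -> ~ U eta x.
have entersP x : exists xi, enters x xi.
  have [|xi [[xi_in xi_min] _]] := woW [pred xi | `[< U xi x >]].
    by exists \top%O; apply/asboolP; rewrite UT.
  exists xi; split; first exact/asboolP.
  move=> eta eta_xi Ueta; have := xi_min eta (asboolT Ueta).
  by rewrite leNgt eta_xi.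
have enters_close x y xi : enters x xi -> enters y xi -> `|f x - f y| < eps.
  move=> [Ux nUx] [Uy nUy].
  have [eta eta_xi] : exists eta, successor_of eta xi.
    apply: contrapT => nsucc; have xi_lim : limit_ordinal xi.
      split; first by move=> xi0; move: Ux; rewrite xi0 U0.
      by move=> eta eta_xi; apply: nsucc; exists eta.
    by move: Ux; rewrite (limU _ xi_lim) => -[eta /nUx].
  rewrite -lte_fin; apply: le_lt_trans (sU _ _ eta_xi).
  apply: ereal_sup_ubound; right.
  have nU z : (forall zeta, (zeta < xi)%O -> ~ U zeta z) -> ~ U eta z.
    by apply; case: eta_xi.
  exists (f x); first by exists x => //; split=> //; exact: nU.
  by exists (f y) => //; exists y => //; split=> //; exact: nU.
have /choice[c cP] xi : exists c, forall x, enters x xi -> `|c - f x| < eps.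
  have [[y yxi]|none] := pselect (exists y, enters y xi).
    by exists (f y) => x; exact: enters_close.
  by exists 0 => x xxi; case: none; exists x.
have [h bh hP] := baire_one_first_positive c woW cW (fun xi => (psiP xi).1).
exists h => // x; have [xi xxi] := entersP x.
rewrite (hP _ xi); [exact: cP|by apply/(psiP xi).2; case: xxi|].
move=> eta eta_xi; rewrite leNgt; apply/negP => /((psiP eta).2 x).
by case: xxi => _; exact.
Qed.

(** [follow v] replaces the sequence [v] by one with steps at most [2^-1 ^+ n]. It
is applied to the given approximations [h] and, for each [m], to the [m]-th
continuous approximations [a n m] of the [h n]. As the bound on the steps does
not depend on [m], the diagonal sequence [b m m] of continuous functions
converges to the limit of the truncated [h n]. At a point of [X], consecutive
[h n] are so close that nothing is truncated, so the limit there is [f]. *)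
Lemma baire_one_extend_approx (f : X -> R) :
  (forall eps : R, 0 < eps ->
    exists2 h : Y -> R, baire_one h & forall x, `|h (e x) - f x| < eps) ->
  exists2 g : Y -> R, baire_one g & forall x, g (e x) = f x.
Proof.
move=> approx.
have /choice[h hP] n : exists h : Y -> R, baire_one h /\
    forall x, `|h (e x) - f x| < 2^-1 ^+ n / 2.
  have [|h] := approx (2^-1 ^+ n / 2); last by exists h.
  by rewrite divr_gt0// half_expr_gt0.
have /choice[a aP] n : exists a : nat -> Y -> R, (forall m, continuous (a m)) /\
    forall y, a m y @[m --> \oo] --> h n y.
  by have [[a ? ?] _] := hP n; exists a.
pose step n (s t : R) := s + clamp (- 2^-1 ^+ n) (2^-1 ^+ n) (t - s).
have step_le n s t : `|step n s t - s| <= 2^-1 ^+ n.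
  rewrite /step addrC addKr ler_norml clamp_itv//.
  by have := half_expr_gt0 R n; lra.
pose fix follow (v : nat -> R) (n : nat) : R :=
  if n is k.+1 then step k (follow v k) (v k.+1) else v 0%N.
have follow_step v n : `|follow v n.+1 - follow v n| <= 2^-1 ^+ n by exact: step_le.
pose b n m y := follow (fun k => a k m y) n.
pose l n y := follow (fun k => h k y) n.
have cstep n (u v : Y -> R) : continuous u -> continuous v ->
    continuous (fun y => step n (u y) (v y)).
  move=> cu cv y; apply: cvgD; first exact: cu.
  apply: (@continuous_comp _ _ _ (fun y => v y - u y) (clamp _ _)).
    by apply: cvgB; [exact: cv|exact: cu].
  exact: clamp_continuous.
have cb n m : continuous (b n m).
  elim: n => [|n ih]; first exact: (aP 0%N).1.
  by apply: cstep => //; exact: (aP n.+1).1.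
have b_cvg n y : b n m y @[m --> \oo] --> l n y.
  elim: n => [|n ih]; first exact: (aP 0%N).2.
  apply: cvgD; first exact: ih.
  apply: continuous_cvg; first exact: clamp_continuous.
  by apply: cvgB; [exact: (aP n.+1).2|exact: ih].
have /choice[g gP] y := geometric_steps_limit (follow_step (fun k => h k y)).
exists g.
  exists (fun m => b m m) => // y; apply/cvgrPdist_lt => eps eps0.
  have [N hN] := @half_expr_lt R (eps / 5) ltac:(lra).
  have /cvgrPdist_lt/(_ (eps / 5) ltac:(lra))[M _ hM] := b_cvg N y.
  exists (maxn N M) => // m /=; rewrite geq_max => /andP[Nm Mm].
  have := hM m Mm; have := gP y N.
  have := geometric_steps_le (follow_step (fun k => a k m y)) Nm.
  have := half_expr_gt0 R m.
  rewrite /= -/(b m m y) -/(b N m y) -/(l N y) !ler_norml !ltr_norml.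
  move=> ? /andP[? ?] /andP[? ?] /andP[? ?].
  by apply/andP; split; lra.
move=> x; have lE n : l n (e x) = h n (e x).
  elim: n => // n; rewrite /l /= => ->; rewrite /step.
  rewrite clamp_id; first by rewrite addrC subrK.
  have := (hP n).2 x; have := (hP n.+1).2 x; rewrite half_exprS.
  rewrite !ltr_norml => /andP[? ?] /andP[? ?].
  by have := half_expr_gt0 R n => ?; apply/andP; split; lra.
apply/eqP; rewrite -subr_eq0 -normr_le0; apply/ler_addgt0Pr => eps eps0.
have [n hn] := @half_expr_lt R (eps / 5) ltac:(lra).
have := gP (e x) n; have := (hP n).2 x; rewrite -/(l n (e x)) lE.
have := half_expr_gt0 R n; rewrite add0r !ler_norml !ltr_norml.
by move=> ? /andP[? ?] /andP[? ?]; apply/andP; split; lra.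
Qed.

End extension.

Theorem theorem6 (R : realType) (X : topologicalType)
    (X_hausdorff : hausdorff_space X)
    (X_completely_regular : completely_regular_space X)
    (f : X -> R) (f_baire_one : baire_one f) :
  functionally_countably_fragmented f <->
  exists2 g : stone_cech R X -> R,
    baire_one g & forall x : X, g (stone_cech_embed R x) = f x.
Proof.
split=> [f_frag|[g g_baire gE] eps eps0].
  apply: baire_one_extend_approx => eps /f_frag.
  apply: fragmented_baire_one_approx; exact: stone_cech_extension.
rewrite (_ : f = g \o @stone_cech_embed R X); last by apply/funext => x; rewrite /= gE.
apply: eps_countably_fragmented_comp; first exact: stone_cech_embed_continuous.
by apply: baire_one_compact_fragmented g_baire eps eps0; exact: stone_cech_compact.
Qed.
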